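(* For every real $c<-2$, one has $\lambda(K^{-}(f_c))>0$.
   Context: For $c\in\mathbb{C}$, $f_c:\mathbb{C}^2\to\mathbb{C}^2$ is the map $f_c(x,y)=(xy+c,x)$. Its inverse $f_c^{-1}(x,y)=\left(y,\frac{x-c}{y}\right)$ is defined at points with $y\neq 0$ and undefined at points with $y=0$; $f_c^{-n}(z)$ exists if $f_c^{-1}$ can be applied $n$ times successively starting from $z$. The backward filled Julia set is $K^{-}(f_c)=\{z\in\mathbb{C}^2:\ f_c^{-n}(z)\text{ exists for all } n\ge 0 \text{ and } \sup_{n\ge 0}\|f_c^{-n}(z)\|<\infty\}$, where $\|(x,y)\|=\max\{|x|,|y|\}$. $\lambda$ denotes Lebesgue measure on $\mathbb{C}^2$ (identified with $\mathbb{R}^4$). *)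

(* Defs.v *)
From mathcomp Require Import all_boot all_order all_algebra complex.
From mathcomp Require Import all_classical all_reals all_analysis.
From mathcomp Require Import measurable_realfun.

Set Implicit Arguments.
Unset Strict Implicit.
Unset Printing Implicit Defensive.

Import Order.TTheory GRing.Theory Num.Theory.
Import numFieldNormedType.Exports.

Local Open Scope classical_set_scope.
Local Open Scope complex_scope.
Local Open Scope ring_scope.

Section Dynamics.
Variable R : realType.
Implicit Types (c : R[i]) (z w : R[i] * R[i]).

Definition fc c z : R[i] * R[i] := (z.1 * z.2 + c, z.1).

(* [None] means that the inverse is undefined at [z]. *)
Definition fc_inv c z : option (R[i] * R[i]) :=
  if z.2 == 0 then None else Some (z.2, (z.1 - c) / z.2).

Lemma fc_invP c z w : fc_inv c z = Some w <-> z.2 != 0 /\ fc c w = z.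
Proof.
case: z w => x y [u v]; rewrite /fc_inv /fc /=; case: eqP => [->|/eqP y0].
  by split=> // -[].
split=> [[<- <-]|[_ [<- yE]]]; first by rewrite mulrC divfK// subrK.
by rewrite yE addrK mulrC mulKf// -yE.
Qed.

Definition fc_inv_iter c (n : nat) z : option (R[i] * R[i]) :=
  iter n (obind (fc_inv c)) (Some z).

Definition maxnorm z : R :=
  Num.max (ComplexField.Normc.normc z.1) (ComplexField.Normc.normc z.2).

Definition Kminus c : set (R[i] * R[i]) :=
  [set z | (forall n, fc_inv_iter c n z != None) /\
    has_ubound [set r | exists n w, fc_inv_iter c n z = Some w /\ r = maxnorm w]].

End Dynamics.

Section LebesgueC2.
Variable R : realType.

Definition C2_of_R4 (p : (R * R) * (R * R)) : R[i] * R[i] :=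
  (p.1.1 +i* p.1.2, p.2.1 +i* p.2.2).

Definition lebesgueR2 := ((@lebesgue_measure R) \x (@lebesgue_measure R))%E.

(* The product measure lives on the Borel sigma-algebra of R^4 and has no
   intended meaning on other sets; Kminus c is Borel by measurable_Kminus. *)
Definition lebesgueC2 (A : set (R[i] * R[i])) : \bar R :=
  (lebesgueR2 \x lebesgueR2)%E (C2_of_R4 @^-1` A).

End LebesgueC2.

Section Measurability.
Variable R : realType.
Local Notation R4 := ((R * R) * (R * R))%type.

Lemma measurable_invr : measurable_fun [set: R] (@GRing.inv R).
Proof.
have -> : [set: R] = [set 0] `|` ~` [set 0] by rewrite setUv.
apply/measurable_funU => //; first exact: measurableC.
split; first exact: measurable_fun_set1.
apply: open_continuous_measurable_fun.
  by apply: closed_openC; exact: closed_eq.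
by move=> x; rewrite inE => /eqP x0; exact: inv_continuous.
Qed.

(* fc_inv in real coordinates, extended by the convention 0^-1 = 0 *)
Definition fc_invR4 (c : R[i]) (p : R4) : R4 :=
  let n := p.2.1 ^+ 2 + p.2.2 ^+ 2 in
  let x := (p.1.1 - complex.Re c, p.1.2 - complex.Im c) in
  let y := (p.2.1 / n, - (p.2.2 / n)) in
  (p.2, (x.1 * y.1 - x.2 * y.2, x.1 * y.2 + x.2 * y.1)).

Lemma measurable_fc_invR4 c : measurable_fun [set: R4] (fc_invR4 c).
Proof.
have m11 : measurable_fun [set: R4] (fun p : R4 => p.1.1).
  exact: measurableT_comp.
have m12 : measurable_fun [set: R4] (fun p : R4 => p.1.2).
  exact: measurableT_comp.
have m21 : measurable_fun [set: R4] (fun p : R4 => p.2.1).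
  exact: measurableT_comp.
have m22 : measurable_fun [set: R4] (fun p : R4 => p.2.2).
  exact: measurableT_comp.
have mn : measurable_fun [set: R4] (fun p : R4 => (p.2.1 ^+ 2 + p.2.2 ^+ 2)^-1).
  apply: (measurableT_comp measurable_invr).
  by apply: measurable_funD; exact: measurable_funX.
rewrite /fc_invR4; apply: measurable_fun_pair => //=.
apply: measurable_fun_pair; [apply: measurable_funB|apply: measurable_funD];
  apply: measurable_funM; do ?apply: measurable_funB => //;
  do ?apply: measurableT_comp => //; exact: measurable_funM.
Qed.

Lemma fc_inv_C2_of_R4 c (p : R4) :
  fc_inv c (C2_of_R4 p) =
  if p.2 == 0 then None else Some (C2_of_R4 (fc_invR4 c p)).
Proof.
case: p c => -[x1 x2] [y1 y2] [c1 c2]; rewrite /fc_inv /C2_of_R4 /=.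
by rewrite eq_complex /= xpair_eqE.
Qed.

Lemma measurable_Kminus c : measurable (@C2_of_R4 R @^-1` Kminus c).
Proof.
pose G n : R4 -> R4 := iter n (fc_invR4 c).
have mG n : measurable_fun [set: R4] (G n).
  elim: n => [|n IH]; first exact: measurable_id.
  by rewrite /G /=; apply: measurableT_comp => //; exact: measurable_fc_invR4.
have -> : @C2_of_R4 R @^-1` Kminus c =
    (\bigcap_n (G n @^-1` [set p | p.2 != 0])) `&`
    \bigcup_k \bigcap_n (G n @^-1` [set p | maxnorm (C2_of_R4 p) <= k%:R]).
  have dom (p : R4) : (forall n, fc_inv_iter c n (C2_of_R4 p) != None) ->
      forall n, fc_inv_iter c n (C2_of_R4 p) = Some (C2_of_R4 (G n p)) /\
                (G n p).2 != 0.
    move=> Kp n.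
    suff E : fc_inv_iter c n (C2_of_R4 p) = Some (C2_of_R4 (G n p)).
      split=> //; have := Kp n.+1; rewrite /fc_inv_iter iterS.
      rewrite -/(fc_inv_iter _ _ _) E /= fc_inv_C2_of_R4.
      by case: ifP.
    elim: n => // n IH; have := Kp n.+1; rewrite /fc_inv_iter iterS.
    rewrite -/(fc_inv_iter _ _ _) IH /= fc_inv_C2_of_R4.
    by case: ifP.
  have dom' (p : R4) : (forall n, (G n p).2 != 0) ->
      forall n, fc_inv_iter c n (C2_of_R4 p) = Some (C2_of_R4 (G n p)).
    move=> Gp; elim=> // n IH; rewrite /fc_inv_iter iterS.
    by rewrite -/(fc_inv_iter _ _ _) IH /= fc_inv_C2_of_R4 (negbTE (Gp n)).
  apply/seteqP; split=> [p [/dom Kp [M ubM]]|p [Gp [k _ Gk]]].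
    split=> [n _|]; first by have [] := Kp n.
    exists (Num.truncn (Num.max M 0)).+1 => // n _ /=.
    have [E _] := Kp n.
    apply: (@le_trans _ _ (Num.max M 0)); last exact/ltW/truncnS_gt.
    rewrite le_max; apply/orP; left.
    by apply: ubM; exists n, (C2_of_R4 (G n p)).
  have {}Gp := dom' p (fun n => Gp n I); split=> [n|]; first by rewrite Gp.
  exists k%:R => _ [n [w [+ ->]]]; rewrite Gp => -[<-].
  exact: Gk.
have mnorm : measurable_fun [set: R4] (fun p : R4 => maxnorm (C2_of_R4 p)).
  have msqrt : measurable_fun [set: R] (@Num.sqrt R).
    by apply: continuous_measurable_fun; exact: sqrt_continuous.
  apply: measurable_maxr => /=; apply: (measurableT_comp msqrt);
    apply: measurable_funD; apply: measurable_funX; exact: measurableT_comp.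
apply: measurableI.
  apply: bigcap_measurable => // n _; rewrite -[X in measurable X]setTI.
  apply: mG => //.
  have -> : [set p : R4 | p.2 != 0] = snd @^-1` (~` ([set 0] `*` [set 0])).
    apply/seteqP; split=> -[q [a b]] /=; first by move=> /eqP + [/= a0 b0]; rewrite a0 b0.
    by move=> h; apply/eqP => -[a0 b0]; apply: h.
  rewrite -[X in measurable X]setTI; apply: measurable_snd => //.
  by apply: measurableC; apply: measurableX.
apply: bigcup_measurable => k _; apply: bigcap_measurable => // n _.
rewrite -[X in measurable X]setTI; apply: mG => //.
rewrite -[X in measurable X]setTI.
rewrite (_ : [set p | _] = (fun p : R4 => maxnorm (C2_of_R4 p)) @^-1` `]-oo, k%:R]).
  by apply: mnorm.
by apply/seteqP; split => p /=; rewrite in_itv.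
Qed.
End Measurability.

(* Main.v *)
(** The point (-a, -a) with a^2 + a + c = 0 and a > 1 is fixed by f_c, and both
    eigenvalues of the derivative of the inverse map there, the roots of
    m^2 + m + 1/a, lie inside the unit disc.  A Hermitian form adapted to this
    derivative decreases along the inverse map near the fixed point, so its small
    sublevel sets are bounded, backward invariant and have nonempty interior. *)
Require Import Defs.
From mathcomp Require Import all_boot all_order all_algebra complex.
From mathcomp Require Import all_classical all_reals all_analysis.
From mathcomp Require Import ring lra.
From HB Require Import structures.

Set Implicit Arguments.
Unset Strict Implicit.
Unset Printing Implicit Defensive.

Import Order.TTheory GRing.Theory Num.Theory.

Local Open Scope classical_set_scope.
Local Open Scope ring_scope.
Local Open Scope complex_scope.

(** * A quadratic form decreased by the linearised inverse map *)

Section LyapunovForm.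
Variables (R : realType) (b : R).

Definition sqnorm (u : R * R) : R := u.1 ^+ 2 + u.2 ^+ 2.

(* Complex numbers are pairs of reals.  For p |u|^2 + 2 q Re(u conj(v)) + r |v|^2,
   requiring that the derivative (u, v) |-> (v, - b u - v) decrease it by a
   multiple of |u|^2 + |v|^2 allows q = b, r = 1 + b and p between b^2 (1 + b) and 2 b;
   p is taken to be the midpoint. *)
Definition lyap (u v : R * R) : R :=
  (b + b ^+ 2 * (1 + b) / 2) * sqnorm u
  + 2 * b * (u.1 * v.1 + u.2 * v.2) + (1 + b) * sqnorm v.

(** Half the distance between the two bounds on p. At the midpoint the form loses the same multiple
    of |u|^2 and of |v|^2. *)
Definition gap : R := b - b ^+ 2 * (1 + b) / 2.

Definition cmul (u v : R * R) : R * R :=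
  (u.1 * v.1 - u.2 * v.2, u.1 * v.2 + u.2 * v.1).

Definition dinv (u v : R * R) : R * R := (- (b * u.1 + v.1), - (b * u.2 + v.2)).

Lemma sqnorm_ge0 u : 0 <= sqnorm u.
Proof. by rewrite addr_ge0 ?sqr_ge0. Qed.

Lemma lyap_dinv u v :
  lyap v (dinv u v) = lyap u v - gap * (sqnorm u + sqnorm v).
Proof. by rewrite /lyap /gap /dinv /sqnorm /=; field. Qed.

Hypotheses (b0 : 0 < b) (b1 : b < 1).

Lemma gap_gt0 : 0 < gap.
Proof.
(* local copies, because [lra] does not see section hypotheses *)
move: (b0) (b1) => b_gt0 b_lt1.
have -> : gap = b * (1 - b) * (2 + b) / 2 by rewrite /gap; field.
by rewrite divr_gt0// !mulr_gt0//; lra.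
Qed.

Lemma gap_lt1 : gap < 1.
Proof.
move: (b0) (b1) => b_gt0 b_lt1.
rewrite /gap; have : 0 < b ^+ 2 * (1 + b) by rewrite mulr_gt0 ?exprn_gt0//; lra.
by lra.
Qed.

Lemma lyap_ge0 u v : 0 <= lyap u v.
Proof.
move: (b0) (b1) => b_gt0 b_lt1.
have -> : lyap u v =
    b * (sqnorm (u.1 + v.1, u.2 + v.2)) + sqnorm v + b ^+ 2 * (1 + b) / 2 * sqnorm u.
  by rewrite /lyap /sqnorm /=; field.
have b2 : 0 <= b ^+ 2 * (1 + b) / 2.
  by rewrite divr_ge0// mulr_ge0 ?sqr_ge0//; lra.
have := mulr_ge0 b2 (sqnorm_ge0 u); have := sqnorm_ge0 v.
have := mulr_ge0 (ltW b0) (sqnorm_ge0 (u.1 + v.1, u.2 + v.2)); lra.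
Qed.

(** The form is still nonnegative after one linear step, so it is at least the amount that this step
    removes. *)
Lemma lyap_ge u v : gap * (sqnorm u + sqnorm v) <= lyap u v.
Proof. by have := lyap_ge0 v (dinv u v); rewrite lyap_dinv; lra. Qed.

Lemma lyap_le u v : lyap u v <= 7 * (sqnorm u + sqnorm v).
Proof.
move: (b0) (b1) => b_gt0 b_lt1.
have := sqnorm_ge0 u; have := sqnorm_ge0 v => nv nu.
have cross : 2 * (u.1 * v.1 + u.2 * v.2) <= sqnorm u + sqnorm v.
  have := sqnorm_ge0 (u.1 - v.1, u.2 - v.2); rewrite /sqnorm /=; nra.
have b21 : b ^+ 2 * (1 + b) <= 2.
  have -> : 2 = 1 * 2 :> R by rewrite mul1r.
  by apply: ler_pM; rewrite ?sqr_ge0 ?expr_le1//; lra.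
have h1 : (b + b ^+ 2 * (1 + b) / 2) * sqnorm u <= 2 * sqnorm u.
  by apply: ler_wpM2r => //; lra.
have h2 : b * (2 * (u.1 * v.1 + u.2 * v.2)) <= b * (sqnorm u + sqnorm v).
  by rewrite ler_pM2l.
have h3 : b * (sqnorm u + sqnorm v) <= 1 * (sqnorm u + sqnorm v).
  by apply: ler_wpM2r; lra.
have h4 : (1 + b) * sqnorm v <= 2 * sqnorm v by apply: ler_wpM2r => //; lra.
rewrite /lyap; lra.
Qed.

(** Parallelogram identity for b u and v, with the square of the difference dropped. *)
Lemma sqnorm_dinv_le u v : sqnorm (dinv u v) <= 2 * (sqnorm u + sqnorm v).
Proof.
have h : sqnorm (dinv u v) + sqnorm (b * u.1 - v.1, b * u.2 - v.2)
    = 2 * (b ^+ 2 * sqnorm u + sqnorm v) by rewrite /sqnorm /=; ring.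
have := sqnorm_ge0 (b * u.1 - v.1, b * u.2 - v.2).
have : b ^+ 2 * sqnorm u <= 1 * sqnorm u.
  by apply: ler_wpM2r; rewrite ?sqnorm_ge0 ?expr_le1// ltW.
lra.
Qed.

(** With d = k - 1, the form changes by a cross term between v and d l, and by a multiple of |k|^2 -
    1 = |d|^2 + 2 Re d <= 3 e. The factor 7 is 1 from the former plus 2 * 3 from the latter. *)
Lemma lyap_cmul_le e k v l : 0 < e <= 1 ->
  sqnorm (k.1 - 1, k.2) <= e ^+ 2 ->
  lyap v (cmul k l) <= lyap v l + e * (7 * sqnorm l + sqnorm v).
Proof.
move: (b0) (b1) => b_gt0 b_lt1.
move=> /andP[e0 e1] ke.
set d := (k.1 - 1, k.2); have := sqnorm_ge0 v; have := sqnorm_ge0 l => nl nv.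
have dE : sqnorm (cmul d l) = sqnorm d * sqnorm l.
  by rewrite /sqnorm /cmul /=; ring.
have -> : lyap v (cmul k l) = lyap v l
    + b * (2 * (v.1 * (cmul d l).1 + v.2 * (cmul d l).2))
    + (1 + b) * ((sqnorm d + 2 * d.1) * sqnorm l).
  by rewrite /lyap /sqnorm /cmul /=; ring.
have dl : sqnorm (cmul d l) <= e ^+ 2 * sqnorm l.
  by rewrite dE; apply: ler_wpM2r.
(* AM-GM: 2 v.w <= e |v|^2 + |w|^2 / e *)
have cross : 2 * (v.1 * (cmul d l).1 + v.2 * (cmul d l).2)
    <= e * (sqnorm l + sqnorm v).
  rewrite -(ler_pM2l e0).
  have := sqnorm_ge0 (e * v.1 - (cmul d l).1, e * v.2 - (cmul d l).2).
  have -> : sqnorm (e * v.1 - (cmul d l).1, e * v.2 - (cmul d l).2) =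
    e ^+ 2 * sqnorm v + sqnorm (cmul d l)
    - e * (2 * (v.1 * (cmul d l).1 + v.2 * (cmul d l).2)).
    by rewrite /sqnorm /=; ring.
  lra.
have d1 : d.1 <= e.
  apply: le_trans (ler_norm _) _; rewrite -ler_sqr ?nnegrE ?(ltW e0)//.
  by rewrite real_normK ?num_real//; apply: le_trans ke; rewrite lerDl sqr_ge0.
have kl : (sqnorm d + 2 * d.1) * sqnorm l <= 3 * e * sqnorm l.
  by apply: ler_wpM2r => //; nra.
have c1 : b * (2 * (v.1 * (cmul d l).1 + v.2 * (cmul d l).2)) <=
   1 * (e * (sqnorm l + sqnorm v)).
  apply: (@le_trans _ _ (b * (e * (sqnorm l + sqnorm v)))).
    by rewrite ler_pM2l.
  apply: ler_wpM2r; last exact: ltW.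
  by rewrite mulr_ge0 ?(ltW e0)// addr_ge0.
have c2 : (1 + b) * ((sqnorm d + 2 * d.1) * sqnorm l) <= 2 * (3 * e * sqnorm l).
  apply: (@le_trans _ _ ((1 + b) * (3 * e * sqnorm l))).
    by rewrite ler_pM2l//; lra.
  apply: ler_wpM2r; last lra.
  by rewrite !mulr_ge0// ltW.
lra.
Qed.

Lemma lyap_contract k u v : sqnorm (k.1 - 1, k.2) <= (gap / 15) ^+ 2 ->
  lyap v (cmul k (dinv u v)) <= lyap u v.
Proof.
move=> kg; have := gap_gt0; have := gap_lt1 => g1 g0.
(* 15 = 7 * 2 + 1, as |l|^2 <= 2 (|u|^2 + |v|^2) for l = [dinv u v]: the linear decrease pays for
   the perturbation. *)
have g15 : 0 < gap / 15 <= 1 by apply/andP; split; lra.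
apply: (le_trans (lyap_cmul_le v (dinv u v) g15 kg)).
rewrite lyap_dinv.
have := sqnorm_dinv_le u v; have := sqnorm_ge0 u => nu nd.
have : gap * (7 * sqnorm (dinv u v) + sqnorm v) <=
    gap * (15 * (sqnorm u + sqnorm v)) by rewrite ler_pM2l//; lra.
lra.
Qed.

End LyapunovForm.

(** * A backward invariant neighbourhood of the fixed point *)

Section FixedPoint.
Variables (R : realType) (c a : R).
Hypotheses (a1 : 1 < a) (ac : a ^+ 2 + a + c = 0).
Local Notation R4 := ((R * R) * (R * R))%type.
Local Notation b := a^-1.
Local Notation gap := (gap b).

Definition shift (x : R * R) : R * R := (x.1 + a, x.2).

(** By [lyap_ge] this level confines p to distance gap / 30 from the fixed point. Dividing by |y| >=
    1/2 then gives the gap / 15 that [lyap_contract] asks for. *)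
Definition trap : set R4 :=
  [set p | lyap b (shift p.1) (shift p.2) <= gap * (gap / 30) ^+ 2].

Let b0 : 0 < b. Proof. by move: (a1) => ?; rewrite invr_gt0; lra. Qed.
Let b1 : b < 1. Proof. by move: (a1) => ?; rewrite invf_lt1//; lra. Qed.
Let g0 : 0 < gap. Proof. exact: gap_gt0. Qed.
Let g1 : gap < 1. Proof. exact: gap_lt1. Qed.

Lemma trap_sqnorm p : trap p ->
  sqnorm (shift p.1) + sqnorm (shift p.2) <= (gap / 30) ^+ 2.
Proof.
by move=> /(le_trans (lyap_ge b0 b1 _ _)); rewrite ler_pM2l.
Qed.

(** The second coordinate y is within 1/2 of -a and a > 1, so y stays away from the pole at 0. *)
Lemma trap_snd_sqnorm p : trap p -> 4^-1 <= sqnorm p.2.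
Proof.
move: (a1) (g0) (g1) => a_gt1 gap0 gap1.
move=> /trap_sqnorm; have := sqnorm_ge0 (shift p.1).
case: p => -[x1 x2] [y1 y2]; rewrite /sqnorm /shift /=.
have : (gap / 30) ^+ 2 <= 4^-1.
  have -> : 4^-1 = (2^-1) ^+ 2 :> R by rewrite expr2; field.
  by rewrite ler_sqr ?nnegrE; lra.
move=> gb h1 h2.
have y1a : (y1 + a) ^+ 2 <= (2^-1) ^+ 2.
  have -> : (2^-1) ^+ 2 = 4^-1 :> R by rewrite expr2; field.
  by have := sqr_ge0 y2; lra.
have : `|y1 + a| <= 2^-1 by rewrite -ler_sqr ?nnegrE ?normr_ge0 ?real_normK ?num_real.
rewrite ler_norml => /andP[_ ya].
have := sqr_ge0 y2; nra.
Qed.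

Lemma trap_snd_neq0 p : trap p -> p.2 != 0.
Proof.
move=> /trap_snd_sqnorm; apply: contraTneq => ->.
by rewrite /sqnorm /= expr0n /= addr0 -ltNge; lra.
Qed.

(* In the coordinates centred at the fixed point, the second component of the
   inverse map is its linear part multiplied by the complex number - a / y. *)
Lemma shift_fc_invR4 p : trap p ->
  let n := sqnorm p.2 in
  shift (fc_invR4 c%:C p).2 =
  cmul (- a * p.2.1 / n, a * p.2.2 / n) (dinv b (shift p.1) (shift p.2)).
Proof.
move: (a1) => a_gt1.
move=> /trap_snd_sqnorm; case: p => -[x1 x2] [y1 y2].
rewrite /sqnorm /shift /cmul /dinv /= => n4.
have n0 : y1 ^+ 2 + y2 ^+ 2 != 0 by apply/lt0r_neq0; lra.
have a0 : a != 0 by apply/lt0r_neq0; lra.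
have -> : c = - a - a ^+ 2 by move: (ac) => ?; lra.
by congr pair; field; apply/andP.
Qed.

Lemma trap_fc_invR4 p : trap p -> trap (fc_invR4 c%:C p).
Proof.
move: (g0) (g1) => gap0 gap1.
move=> tp; apply: (@le_trans _ _ (lyap b (shift p.1) (shift p.2))); last exact: tp.
rewrite shift_fc_invR4// [X in shift X]/=; apply: lyap_contract => //=.
have := trap_snd_sqnorm tp; have := trap_sqnorm tp.
have := sqnorm_ge0 (shift p.1).
set n := sqnorm p.2 => h0 h1 n4; have n0 : 0 < n by lra.
(* For k = - a / y, one has k - 1 = - (y + a) / y. *)
have -> : sqnorm (- a * p.2.1 / n - 1, a * p.2.2 / n) = sqnorm (shift p.2) / n.
  have nE : n = p.2.1 ^+ 2 + p.2.2 ^+ 2 by [].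
  rewrite /sqnorm /shift /=; move: nE n0; case: (p.2) => y1 y2 /= -> /lt0r_neq0 ?.
  by field.
rewrite ler_pdivrMr//.
have : (gap / 15) ^+ 2 * 4^-1 <= (gap / 15) ^+ 2 * n by rewrite ler_pM2l ?exprn_gt0//; lra.
have -> : (gap / 15) ^+ 2 * 4^-1 = (gap / 30) ^+ 2 by field.
lra.
Qed.

Lemma fc_inv_iter_trap n p : trap p ->
  exists2 q, trap q & fc_inv_iter c%:C n (C2_of_R4 p) = Some (C2_of_R4 q).
Proof.
move=> tp; elim: n => [|n [q tq E]]; first by exists p.
exists (fc_invR4 c%:C q); first exact: trap_fc_invR4.
rewrite /fc_inv_iter iterS -/(fc_inv_iter _ _ _) E /= fc_inv_C2_of_R4.
by rewrite (negbTE (trap_snd_neq0 tq)).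
Qed.

Lemma maxnorm_trap p : trap p -> maxnorm (C2_of_R4 p) <= Num.sqrt (2 * a ^+ 2 + 2).
Proof.
move: (g0) (g1) => gap0 gap1.
move=> /trap_sqnorm.
have : (gap / 30) ^+ 2 <= 1 by rewrite expr_le1//; lra.
have := sqnorm_ge0 (shift p.1); have := sqnorm_ge0 (shift p.2).
move=> n2 n1 g h.
have bd x : sqnorm (shift x) <= 1 -> sqnorm x <= 2 * a ^+ 2 + 2.
  case: x => x1 x2; rewrite /sqnorm /shift /=.
  (* 2 |x + a|^2 + 2 a^2 - |x|^2 = |x + 2 a|^2. *)
  have := sqr_ge0 (x1 + 2 * a); have := sqr_ge0 x2; nra.
by rewrite /maxnorm ge_max; apply/andP; split; apply: ler_wsqrtr; apply: bd; lra.
Qed.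

Lemma trap_sub_Kminus : trap `<=` @C2_of_R4 R @^-1` Kminus c%:C.
Proof.
move=> p tp; split=> [n|].
  by have [q _ ->] := fc_inv_iter_trap n tp.
exists (Num.sqrt (2 * a ^+ 2 + 2)) => _ [n [w [+ ->]]].
by have [q tq ->] := fc_inv_iter_trap n tp => -[<-]; exact: maxnorm_trap.
Qed.

Lemma box_sub_trap : exists2 t, 0 < t &
  (`[- a - t, - a + t] `*` `[- t, t]) `*` (`[- a - t, - a + t] `*` `[- t, t])
  `<=` trap.
Proof.
move: (g0) (g1) => gap0 gap1.
set rho := gap * (gap / 30) ^+ 2.
have r0 : 0 < rho by rewrite mulr_gt0 ?exprn_gt0//; lra.
have r1 : rho <= 1.
  by rewrite mulr_ile1 ?expr_le1 ?exprn_ge0//; lra.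
(* [lyap_le] gives 7 times a sum of four squares, each at most t^2 <= t, and 28 t = rho. *)
exists (rho / 28); first lra.
set t := rho / 28; have tE : rho = 28 * t by rewrite /t; field.
have sq s : - t <= s <= t -> s ^+ 2 <= t ^+ 2.
  move=> st; rewrite -[leLHS]real_normK ?num_real// ler_sqr ?nnegrE ?normr_ge0//.
    by rewrite ler_norml.
  by rewrite /t; lra.
case=> -[x1 x2] [y1 y2] /= [[]]; rewrite !in_itv /=.
move=> hx1 hx2 [hy1 hy2]; apply: (le_trans (lyap_le b0 b1 _ _)).
rewrite -/rho /sqnorm /shift /=.
have := sq (x1 + a); have := sq x2; have := sq (y1 + a); have := sq y2.
move=> /(_ hy2) q1 /(_ ltac:(lra)) q2 /(_ hx2) q3 /(_ ltac:(lra)) q4.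
have : t ^+ 2 <= t by rewrite expr2 ler_piMl; lra.
lra.
Qed.

End FixedPoint.

(** * Positive measure from a box *)

(* Canonical inference of a sigma-finite structure on [m1 \x m2] only succeeds
   for subprobabilities: that instance shadows the general one, which is
   therefore repackaged by hand. *)
Definition product_sigma_finite d1 d2 (T1 : measurableType d1)
    (T2 : measurableType d2) (R : realType)
    (m1 : {sigma_finite_measure set T1 -> \bar R})
    (m2 : {sigma_finite_measure set T2 -> \bar R}) :
    {sigma_finite_measure set (T1 * T2)%type -> \bar R} :=
  HB.pack (m1 \x m2)%E
    (lebesgue_integral_fubini.measure_function_Measure_isSigmaFinite__to__measure_function_isSigmaFinite m1 m2)
    (lebesgue_integral_fubini.measure_function_Measure_isSigmaFinite__to__measure_function_isSFinite m1 m2).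

Lemma lebesgueC2_box_gt0 (R : realType) (A : set (R[i] * R[i])) (I J K L : set R) :
  measurable (@C2_of_R4 R @^-1` A) ->
  measurable I -> measurable J -> measurable K -> measurable L ->
  (I `*` J) `*` (K `*` L) `<=` @C2_of_R4 R @^-1` A ->
  (0 < lebesgue_measure I)%E -> (0 < lebesgue_measure J)%E ->
  (0 < lebesgue_measure K)%E -> (0 < lebesgue_measure L)%E ->
  (0 < lebesgueC2 A)%E.
Proof.
move=> mA mI mJ mK mL sub I0 J0 K0 L0.
have mIJ : measurable (I `*` J) by exact: measurableX.
have mKL : measurable (K `*` L) by exact: measurableX.
have mB : measurable ((I `*` J) `*` (K `*` L)) by exact: measurableX.
pose l : {sigma_finite_measure set _ -> \bar R} := @lebesgue_measure R.
pose m := product_sigma_finite l l.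
pose M := product_sigma_finite m m.
(* [M] unfolds to the measure in [lebesgueC2], so monotonicity reduces the claim to the box. *)
suff : (0 < M ((I `*` J) `*` (K `*` L)))%E.
  by move=> /lt_le_trans; apply; apply: le_measure => //; rewrite inE.
have -> : M ((I `*` J) `*` (K `*` L)) =
    (lebesgue_measure I * lebesgue_measure J *
     (lebesgue_measure K * lebesgue_measure L))%E.
  rewrite -(product_measure1E l l mI mJ) -(product_measure1E l l mK mL).
  exact: (product_measure1E m m mIJ mKL).
by rewrite !mule_gt0.
Qed.

Theorem proposition2p14 (R : realType) (c : R) :
  c < - 2 -> (0 < lebesgueC2 (Kminus c%:C))%E.
Proof.
(* [a] is the larger root of X^2 + X + c, and c < -2 amounts to s > 3, that is a > 1. *)
move=> c2; pose s := Num.sqrt (1 - 4 * c); pose a := (s - 1) / 2.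
have s2 : s ^+ 2 = 1 - 4 * c by rewrite sqr_sqrtr//; lra.
have s3 : 3 < s.
  by rewrite -ltr_sqr ?nnegrE ?sqrtr_ge0// s2; lra.
have a1 : 1 < a by rewrite /a; lra.
have ac : a ^+ 2 + a + c = 0.
  have -> : a ^+ 2 + a + c = (s ^+ 2 - 1) / 4 + c by rewrite /a; field.
  by rewrite s2; field.
have [t t0 boxt] := box_sub_trap a1.
have itv_gt0 (x y : R) : x < y -> (0 < lebesgue_measure `[x, y]%classic)%E.
  by move=> xy; rewrite lebesgue_measure_itv /= lte_fin xy -EFinB lte_fin subr_gt0.
apply: (lebesgueC2_box_gt0 (measurable_Kminus c%:C) _ _ _ _
  (subset_trans boxt (trap_sub_Kminus a1 ac))); do ?exact: measurable_itv;
  by apply: itv_gt0; lra.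
Qed.
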